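(* Let $\kappa\in\mathbb{R}$ with $\kappa\neq 0$, let $M^2_\kappa$ be the simply connected surface of constant curvature $\kappa$, and let $M^3=M^2_\kappa\times\mathbb{R}$ with the product metric $g$. Let $E_3=\partial_t$ be the unit vector field tangent to the $\mathbb{R}$ factor. Then every trans-Sasakian structure $(\varphi,\xi,\eta,g)$ on $M^3$ compatible with the product metric $g$ is vertical; more precisely, on each connected component of $M^3$, $\xi=\pm E_3$. Hence every such structure is cosymplectic.
   Context: An almost contact metric structure $(\varphi,\xi,\eta,g)$ on a manifold $M$ consists of a $(1,1)$-tensor field $\varphi$, a vector field $\xi$, a $1$-form $\eta$ and a Riemannian metric $g$ with $\varphi^2=-I+\eta\otimes\xi$, $\eta(\xi)=1$, $\varphi\xi=0$, $\eta\circ\varphi=0$, $g(\varphi X,\varphi Y)=g(X,Y)-\eta(X)\eta(Y)$. It is trans-Sasakian of type $(\alpha,\beta)$ if there are smooth functions $\alpha,\beta$ on $M$ such that for all vector fields $X,Y$ $$(\nabla_X\varphi)Y=\alpha\bigl(g(X,Y)\xi-\eta(Y)X\bigr)+\beta\bigl(g(\varphi X,Y)\xi-\eta(Y)\varphi X\bigr),$$ where $\nabla$ is the Levi-Civita connection of $g$. It is cosymplectic if $\alpha=\beta=0$. ''Compatible with $g$'' means that the metric of the structure is the given fixed metric $g$; no homogeneity or invariance of $\varphi,\xi,\eta,\alpha,\beta$ is assumed. ''Vertical'' means that $\xi$ is tangent to the $\mathbb{R}$ factor. *)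

(* Defs.v *)
From mathcomp Require Export all_boot all_order all_algebra.
From mathcomp Require Export all_classical all_reals all_analysis.

Set Implicit Arguments.
Unset Strict Implicit.
Unset Printing Implicit Defensive.

Export Order.TTheory GRing.Theory Num.Theory.
Export numFieldNormedType.Exports.

Global Open Scope classical_set_scope.
Global Open Scope ring_scope.

(** Differential geometry of an embedded submanifold [M] of a
    finite-dimensional normed space [E]. Tensor fields on [M] are represented by
    functions on all of [E]; only their values at points of [M] and on vectors
    tangent to [M] are constrained or used. *)

(* On an open set of a finite-dimensional space, C^(k+1) means: differentiable,
   with every directional derivative of class C^k. *)
Fixpoint Ck (R : realType) (E F : normedModType R) (k : nat) (U : set E)
    (f : E -> F) : Prop :=
  match k with
  | 0 => forall p, U p -> {for p, continuous f}
  | k'.+1 => (forall p, U p -> differentiable f p) /\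
             (forall v : E, Ck k' U (fun p => 'D_v f p))
  end.

Definition smooth_in (R : realType) (E F : normedModType R) (U : set E)
    (f : E -> F) : Prop :=
  forall k, Ck k U f.

Definition smooth_on (R : realType) (E F : normedModType R) (M : set E)
    (f : E -> F) : Prop :=
  forall p, M p -> exists (U : set E) (f' : E -> F),
    [/\ open U, U p, smooth_in U f' & forall q, M q -> U q -> f q = f' q].

(* [c] is a smooth curve in [M], defined near 0, with c(0) = p and c'(0) = v. *)
Definition curve_through (R : realType) (E : normedModType R) (M : set E)
    (p v : E) (c : R -> E) : Prop :=
  c 0 = p /\ 'D_1 c 0 = v /\
  exists U : set R,
    [/\ open U, U 0, smooth_in U c & forall s, U s -> M (c s)].

Definition tangent (R : realType) (E : normedModType R) (M : set E)
    (p : E) : set E :=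
  [set v | exists c, curve_through M p v c].

Definition vector_field (R : realType) (E : normedModType R) (M : set E)
    (X : E -> E) : Prop :=
  smooth_on M X /\ forall p, M p -> tangent M p (X p).

(* X f at p is (f o c)'(0) for any curve c in M through p with velocity X_p;
   for [f] smooth on [M] the value does not depend on [c]. *)
Definition dir_deriv (R : realType) (E : normedModType R) (M : set E)
    (X : E -> E) (f : E -> R) (p : E) : R :=
  get [set l : R | exists2 c : R -> E,
         curve_through M p (X p) c & l = 'D_1 (f \o c) 0].

Record riemannian_metric (R : realType) (E : normedModType R) (M : set E)
    (g : E -> E -> E -> R) : Prop := {
  metric_linear : forall p u v w (a : R),
    M p -> tangent M p u -> tangent M p v -> tangent M p w ->
    g p (a *: u + v) w = a * g p u w + g p v w;
  metric_sym : forall p u v,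
    M p -> tangent M p u -> tangent M p v -> g p u v = g p v u;
  metric_pos : forall p u,
    M p -> tangent M p u -> u != 0 -> 0 < g p u u;
  metric_smooth : forall X Y,
    vector_field M X -> vector_field M Y ->
    smooth_on M (fun p => g p (X p) (Y p)) }.

Record affine_connection (R : realType) (E : normedModType R) (M : set E)
    (nabla : (E -> E) -> (E -> E) -> E -> E) : Prop := {
  connection_field : forall X Y,
    vector_field M X -> vector_field M Y -> vector_field M (nabla X Y);
  connection_linear : forall (f : E -> R) X X' Y p,
    smooth_on M f ->
    vector_field M X -> vector_field M X' -> vector_field M Y -> M p ->
    nabla (fun q => f q *: X q + X' q) Y p = f p *: nabla X Y p + nabla X' Y p;
  connection_additive : forall X Y Y' p,
    vector_field M X -> vector_field M Y -> vector_field M Y' -> M p ->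
    nabla X (fun q => Y q + Y' q) p = nabla X Y p + nabla X Y' p;
  connection_leibniz : forall (f : E -> R) X Y p,
    smooth_on M f -> vector_field M X -> vector_field M Y -> M p ->
    nabla X (fun q => f q *: Y q) p
      = dir_deriv M X f p *: Y p + f p *: nabla X Y p }.

(* [levi_civita_torsion] is nabla_X Y - nabla_Y X = [X, Y], where both sides are
   applied to functions as derivations. *)
Record levi_civita (R : realType) (E : normedModType R) (M : set E)
    (g : E -> E -> E -> R) (nabla : (E -> E) -> (E -> E) -> E -> E) : Prop := {
  levi_civita_connection : affine_connection M nabla;
  levi_civita_metric : forall X Y Z p,
    vector_field M X -> vector_field M Y -> vector_field M Z -> M p ->
    dir_deriv M X (fun q => g q (Y q) (Z q)) p
      = g p (nabla X Y p) (Z p) + g p (Y p) (nabla X Z p);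
  levi_civita_torsion : forall X Y (f : E -> R) p,
    vector_field M X -> vector_field M Y -> smooth_on M f -> M p ->
    dir_deriv M (fun q => nabla X Y q - nabla Y X q) f p
      = dir_deriv M X (dir_deriv M Y f) p - dir_deriv M Y (dir_deriv M X f) p }.

Record tensor11_field (R : realType) (E : normedModType R) (M : set E)
    (phi : E -> E -> E) : Prop := {
  tensor11_tangent : forall p u,
    M p -> tangent M p u -> tangent M p (phi p u);
  tensor11_linear : forall p u v (a : R),
    M p -> tangent M p u -> tangent M p v ->
    phi p (a *: u + v) = a *: phi p u + phi p v;
  tensor11_smooth : forall X,
    vector_field M X -> smooth_on M (fun p => phi p (X p)) }.

Record one_form (R : realType) (E : normedModType R) (M : set E)
    (eta : E -> E -> R) : Prop := {
  one_form_linear : forall p u v (a : R),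
    M p -> tangent M p u -> tangent M p v ->
    eta p (a *: u + v) = a * eta p u + eta p v;
  one_form_smooth : forall X,
    vector_field M X -> smooth_on M (fun p => eta p (X p)) }.

Record almost_contact_metric (R : realType) (E : normedModType R) (M : set E)
    (phi : E -> E -> E) (xi : E -> E) (eta : E -> E -> R)
    (g : E -> E -> E -> R) : Prop := {
  acm_phi : tensor11_field M phi;
  acm_xi : vector_field M xi;
  acm_eta : one_form M eta;
  acm_g : riemannian_metric M g;
  acm_phi2 : forall p u, M p -> tangent M p u ->
    phi p (phi p u) = - u + eta p u *: xi p;
  acm_eta_xi : forall p, M p -> eta p (xi p) = 1;
  acm_phi_xi : forall p, M p -> phi p (xi p) = 0;
  acm_eta_phi : forall p u, M p -> tangent M p u -> eta p (phi p u) = 0;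
  acm_compat : forall p u v, M p -> tangent M p u -> tangent M p v ->
    g p (phi p u) (phi p v) = g p u v - eta p u * eta p v }.

(* [nabla] is meant to be the Levi-Civita connection of [g]; the left-hand side
   of [trans_sasakian_eq] is (nabla_X phi) Y. *)
Record trans_sasakian (R : realType) (E : normedModType R) (M : set E)
    (nabla : (E -> E) -> (E -> E) -> E -> E)
    (phi : E -> E -> E) (xi : E -> E) (eta : E -> E -> R)
    (g : E -> E -> E -> R) (alpha beta : E -> R) : Prop := {
  trans_sasakian_acm : almost_contact_metric M phi xi eta g;
  trans_sasakian_alpha : smooth_on M alpha;
  trans_sasakian_beta : smooth_on M beta;
  trans_sasakian_eq : forall X Y p,
    vector_field M X -> vector_field M Y -> M p ->
    nabla X (fun q => phi q (Y q)) p - phi p (nabla X Y p)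
      = alpha p *: (g p (X p) (Y p) *: xi p - eta p (Y p) *: X p)
      + beta p *: (g p (phi p (X p)) (Y p) *: xi p
                   - eta p (Y p) *: phi p (X p)) }.

Definition cosymplectic (R : realType) (E : normedModType R) (M : set E)
    (nabla : (E -> E) -> (E -> E) -> E -> E)
    (phi : E -> E -> E) (xi : E -> E) (eta : E -> E -> R)
    (g : E -> E -> E -> R) (alpha beta : E -> R) : Prop :=
  trans_sasakian M nabla phi xi eta g alpha beta /\
  forall p, M p -> alpha p = 0 /\ beta p = 0.

(** The simply connected (complete) surface of constant curvature [kappa <> 0]:
    for [kappa > 0] the sphere of radius 1 / sqrt kappa in Euclidean space, for
    [kappa < 0] the upper sheet of the hyperboloid <x, x> = 1 / kappa in
    Minkowski space. *)

Definition ambient_form (R : realType) (kappa : R) (u v : 'rV[R]_3) : R :=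
  u 0 0 * v 0 0 + u 0 1 * v 0 1 + Num.sg kappa * (u 0 2 * v 0 2).

Definition space_form (R : realType) (kappa : R) : set 'rV[R]_3 :=
  [set x | ambient_form kappa x x = kappa^-1 /\ (kappa < 0 -> 0 < x 0 2)].

Definition space_form_metric (R : realType) (kappa : R)
    (_ u v : 'rV[R]_3) : R :=
  ambient_form kappa u v.

Definition product_metric (R : realType) (E F : normedModType R)
    (g : E -> E -> E -> R) (h : F -> F -> F -> R) (p u v : E * F) : R :=
  g p.1 u.1 v.1 + h p.2 u.2 v.2.

Definition M3 (R : realType) (kappa : R) : set ('rV[R]_3 * R) :=
  space_form kappa `*` setT.

Definition g3 (R : realType) (kappa : R) (p u v : 'rV[R]_3 * R) : R :=
  product_metric (@space_form_metric R kappa) (fun _ a b : R => a * b) p u v.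

Definition E3 (R : realType) (p : 'rV[R]_3 * R) : 'rV[R]_3 * R := (0, 1).

Definition vertical (R : realType) (M : set ('rV[R]_3 * R))
    (xi : 'rV[R]_3 * R -> 'rV[R]_3 * R) : Prop :=
  forall p, M p -> (xi p).1 = 0.

(* Main.v *)
From HB Require Import structures.
From mathcomp Require Import ring lra.
Require Import Defs.

Set Implicit Arguments.
Unset Strict Implicit.
Unset Printing Implicit Defensive.

(* For a trans-Sasakian structure one has
     nabla_X xi = - alpha phi X + beta (X - eta(X) xi),
   and a second differentiation shows that X |-> R(X, xi)xi is of the form
   l + m phi on the orthogonal complement of xi. In the product of a surface of
   curvature kappa with a line, R(X, xi)xi = kappa (|xi_h|^2 X_h - <X_h, xi_h> xi_h)
   with _h the component tangent to the surface. Testing with X = E3 gives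
   l |xi_h|^2 = 0, and with X = phi E3, a horizontal vector orthogonal to xi of
   norm |xi_h|, gives kappa |xi_h|^4 = l |xi_h|^2; hence xi_h = 0. A vertical
   unit field is parallel, so alpha = beta = 0. *)

(** * Functions of class C^k *)

(** The obstruction is one of rank. On the plane orthogonal to [xi], [phi] is multiplication by i,
    so l + m phi is a complex number, zero or invertible. The product curvature kills the projection
    of [E3] to that plane, nonzero unless [xi] is vertical, and has the eigenvalue kappa |xi_h|^2 in
    the orthogonal direction. Both tests read diagonal entries, to which the skew map [phi]
    contributes nothing, so m drops out. The number l + m i comes from a Riccati equation: nabla xi
    is A = beta - i alpha on the plane, [phi] is parallel along [xi], [xi] is geodesic, and R(X,
    xi)xi = - (xi(A) + A^2) X. The obstacle is that [nabla] is given by axioms only, on functions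
    whose values off M are arbitrary, while derivatives are defined through a choice of curve. Hence
    [nabla] has to be identified with the tangential part of flat differentiation, which makes it
    depend only on values on M and turns its curvature into the Gauss equation of a quadric. *)

Lemma near_eq_differentiable (R : realType) (E F : normedModType R)
    (f g : E -> F) (p : E) :
  (\near p, f p = g p) -> differentiable f p -> differentiable g p.
Proof.
move=> fg df; have [dfc fE] := (diff_locallyP p f).1 df.
have gE : g \o shift p = cst (g p) + 'd f p +o_ 0 id.
  apply/eqaddoP => e e0; move/eqaddoP : fE => /(_ e e0) fE.
  have fg0 : \forall x \near (0 : E), f (shift p x) = g (shift p x).
    have : shift p x @[x --> (0 : E)] --> (0 + p : E).
      by apply: cvgD; [exact: cvg_id | exact: cvg_cst].
    by rewrite add0r => /(_ _ fg).
  apply: filterS2 fE fg0 => x; rewrite !fctE /= => le_x fgx.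
  by rewrite -fgx -(nbhs_singleton fg).
by apply/diff_locallyP; rewrite (diff_unique dfc gE).
Qed.

(** Scaling is a continuous bilinear map, so its differential is known, and the chain rule after
    pairing [f] with [g] gives the product rule. [R^o] is [R] seen as a module over itself. *)
Lemma differentiable_scale (R : realType) (E F : normedModType R)
    (f : E -> R) (g : E -> F) (p : E) :
  differentiable f p -> differentiable g p ->
  differentiable (fun q => f q *: g q) p /\
  forall v, 'D_v (fun q => f q *: g q) p = 'D_v f p *: g p + f p *: 'D_v g p.
Proof.
move=> df dg.
have bil : bilinear_for (GRing.Scale.Law.clone _ _ *:%R _)
    (GRing.Scale.Law.clone _ _ *:%R _) (@GRing.scale R F : R^o -> F -> F).
  by split=> [u'|u] a x y /=; rewrite ?scalerDl ?scalerDr !scalerA // mulrC.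
pose sM := bilinear_isBilinear.Build R R^o F F _ _ (@GRing.scale R F : R^o -> F -> F) bil.
pose s : {bilinear R^o -> F -> F} := HB.pack (@GRing.scale R F : R^o -> F -> F) sM.
have sc : continuous (fun q : R^o * F => s q.1 q.2) by exact: scale_continuous.
have ds := @differentiable_bilin _ _ _ _ s (f p, g p) sc.
have dp : differentiable (fun q => (f q : R^o, g q)) p by exact: differentiable_pair.
split; first exact: (differentiable_comp dp ds).
move=> v; rewrite !deriveE//; last exact: (differentiable_comp dp ds).
have -> : (fun q => f q *: g q)
    = (fun q : R^o * F => s q.1 q.2) \o (fun q => (f q : R^o, g q)) by [].
by rewrite diff_comp// diff_bilin//= diff_pair//= addrC.
Qed.

Section Ck.
Context {R : realType}.
Implicit Types E F G : normedModType R.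

Lemma open_near_eq E F (U : set E) (f g : E -> F) (p : E) :
  open U -> U p -> (forall q, U q -> f q = g q) -> \near p, f p = g p.
Proof. by move=> oU Up fg; apply: filterS (open_nbhs_nbhs (conj oU Up)). Qed.

(** Since [U] is open, agreement on [U] is agreement near each of its points, so it passes to the
    directional derivatives. *)
Lemma Ck_eq E F k (U : set E) (f g : E -> F) :
  open U -> (forall q, U q -> f q = g q) -> Ck k U f -> Ck k U g.
Proof.
move=> oU; elim: k f g => [|k IHk] f g fg /=.
  move=> cf p Up; rewrite /prop_for /continuous_at -(fg p Up).
  apply: (cvg_trans _ (cf p Up)).
  exact: near_eq_cvg (open_near_eq oU Up (fun q Uq => fg q Uq)).
move=> [df Df]; split=> [p Up|v].
  exact: near_eq_differentiable (open_near_eq oU Up fg) (df p Up).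
apply: IHk (Df v) => q Uq; exact: near_eq_derive (open_near_eq oU Uq fg).
Qed.

Lemma Ck_sub E F k (U V : set E) (f : E -> F) :
  V `<=` U -> Ck k U f -> Ck k V f.
Proof.
move=> VU; elim: k f => [|k IHk] f /=; first by move=> cf p /VU; exact: cf.
by move=> [df Df]; split=> [p /VU|v]; [exact: df | exact: IHk].
Qed.

Lemma CkW E F k (U : set E) (f : E -> F) : Ck k.+1 U f -> Ck k U f.
Proof.
elim: k f => [|k IHk] f /= [df Df].
  by move=> p /df; exact: differentiable_continuous.
by split=> // v; exact: IHk.
Qed.

Lemma Ck_cst E F k (U : set E) (a : F) : Ck k U (cst a : E -> F).
Proof.
elim: k a => [|k IHk] a /=; first by move=> p _; exact: cst_continuous.
split=> [p _|v]; first exact: differentiable_cst.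
have -> : (fun p => 'D_v (cst a : E -> F) p) = cst 0.
  by apply/funext => p; rewrite derive_cst.
exact: IHk.
Qed.

Lemma Ck_add E F k (U : set E) (f g : E -> F) : open U ->
  Ck k U f -> Ck k U g -> Ck k U (fun p => f p + g p).
Proof.
move=> oU; elim: k f g => [|k IHk] f g /=.
  by move=> cf cg p Up; apply: cvgD; [exact: cf | exact: cg].
move=> [df Df] [dg Dg]; split=> [p Up|v].
  by apply: differentiableD; [exact: df | exact: dg].
apply: Ck_eq (IHk _ _ (Df v) (Dg v)) => // p Up.
by rewrite deriveD//; apply: diff_derivable; [exact: df | exact: dg].
Qed.

Lemma Ck_scale E F k (U : set E) (f : E -> R) (g : E -> F) : open U ->
  Ck k U f -> Ck k U g -> Ck k U (fun p => f p *: g p).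
Proof.
move=> oU; elim: k f g => [|k IHk] f g.
  by move=> cf cg p Up; apply: cvgZ; [exact: cf | exact: cg].
move=> Cf Cg; have [[df Df] [dg Dg]] := (Cf, Cg); split=> [p Up|v].
  by have [] := differentiable_scale (df p Up) (dg p Up).
have := Ck_add oU (IHk _ _ (Df v) (CkW Cg)) (IHk _ _ (CkW Cf) (Dg v)).
apply: Ck_eq => // p Up.
by have [_ ->] := differentiable_scale (df p Up) (dg p Up).
Qed.

(** The derivative - (1/f)^2 Df involves 1/f only to the order already reached, so the induction
    closes with [Ck_scale]. *)
Lemma Ck_inv E k (U : set E) (f : E -> R) : open U ->
  (forall p, U p -> f p != 0) -> Ck k U f -> Ck k U (fun p => (f p)^-1).
Proof.
move=> oU f0; elim: k => [|k IHk].
  by move=> cf p Up; apply: cvgV; [exact: f0 | exact: cf].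
move=> Cf; have [df Df] := Cf; split=> [p Up|v].
  by apply: differentiableV; [exact: df | exact: f0].
have Cv := IHk (CkW Cf).
have := Ck_scale oU (@Ck_cst E R k U (-1)) (Ck_scale oU (Ck_scale oU Cv Cv) (Df v)).
apply: Ck_eq => // p Up.
rewrite deriveV ?f0//; last exact/diff_derivable/df.
by rewrite /= /cst scaleN1r scaleNr -exprVn expr2.
Qed.

Lemma linear_diff E F (L : E -> F) (p : E) : linear L -> continuous L ->
  differentiable L p /\ 'd L p = L :> (E -> F).
Proof.
move=> linL Lc.
pose LM := GRing.isLinear.Build _ _ _ _ _ linL.
pose L' : {linear E -> F} := HB.pack L LM.
by split; [exact: (@linear_differentiable _ _ _ L') | exact: (@diff_lin _ _ _ L')].
Qed.

Lemma Ck_lin E F G k (U : set E) (L : F -> G) (f : E -> F) :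
  linear L -> continuous L -> open U -> Ck k U f -> Ck k U (fun p => L (f p)).
Proof.
move=> linL Lc oU; elim: k f => [|k IHk] f /=.
  by move=> cf p Up; apply: continuous_comp; [exact: cf | exact: Lc].
move=> [df Df]; have dL q := linear_diff q linL Lc.
split=> [p Up|v]; first exact: differentiable_comp (df p Up) (dL _).1.
apply: Ck_eq (IHk _ (Df v)) => // p Up.
rewrite !deriveE//; first last.
- exact: df.
- exact: differentiable_comp (df p Up) (dL _).1.
by rewrite (diff_comp (df p Up) (dL _).1) /= (dL _).2.
Qed.

Lemma Ck_id E k (U : set E) : Ck k U (id : E -> E).
Proof.
case: k => [|k] /=; first by move=> p _; exact: cvg_id.
split=> [p _|v]; first by [].
have -> : (fun p => 'D_v (id : E -> E) p) = cst v.
  by apply/funext => p; rewrite derive_id.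
exact: Ck_cst.
Qed.

End Ck.

(** * Smooth functions on a subset and derivatives along tangent vectors *)

Section SmoothOn.
Context {R : realType}.
Implicit Types E F G : normedModType R.

Lemma smooth_on_global E F (M : set E) (f : E -> F) :
  smooth_in setT f -> smooth_on M f.
Proof. by move=> sf p _; exists setT, f; split=> //; exact: openT. Qed.

Lemma smooth_on_eq E F (M : set E) (f g : E -> F) :
  (forall p, M p -> f p = g p) -> smooth_on M f -> smooth_on M g.
Proof.
move=> fg sf p Mp; have [U [f' [oU Up sf' ff']]] := sf p Mp.
by exists U, f'; split=> // q Mq Uq; rewrite -fg// ff'.
Qed.

Lemma smooth_on_cst E F (M : set E) (a : F) : smooth_on M (fun=> a).
Proof. by apply: smooth_on_global => k; exact: Ck_cst. Qed.

Lemma smooth_on_id E (M : set E) : smooth_on M id.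
Proof. by apply: smooth_on_global => k; exact: Ck_id. Qed.

Arguments smooth_on_cst {E F} M a.
Arguments smooth_on_id {E} M.

Lemma smooth_on_lin E F G (M : set E) (L : F -> G) (f : E -> F) :
  linear L -> continuous L -> smooth_on M f -> smooth_on M (fun p => L (f p)).
Proof.
move=> linL Lc sf p Mp; have [U [f' [oU Up sf' ff']]] := sf p Mp.
exists U, (fun p => L (f' p)); split=> // [k|q Mq Uq]; first exact: Ck_lin.
by rewrite ff'.
Qed.

Lemma smooth_on_add E F (M : set E) (f g : E -> F) :
  smooth_on M f -> smooth_on M g -> smooth_on M (fun p => f p + g p).
Proof.
move=> sf sg p Mp; have [U [f' [oU Up sf' ff']]] := sf p Mp.
have [V [g' [oV Vp sg' gg']]] := sg p Mp.
exists (U `&` V), (fun p => f' p + g' p); split=> //; first exact: openI.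
  move=> k; apply: Ck_add; first exact: openI.
    exact: Ck_sub (@subIsetl _ _ _) (sf' k).
  exact: Ck_sub (@subIsetr _ _ _) (sg' k).
by move=> q Mq [Uq Vq]; rewrite ff' ?gg'.
Qed.

Lemma smooth_on_scale E F (M : set E) (f : E -> R) (g : E -> F) :
  smooth_on M f -> smooth_on M g -> smooth_on M (fun p => f p *: g p).
Proof.
move=> sf sg p Mp; have [U [f' [oU Up sf' ff']]] := sf p Mp.
have [V [g' [oV Vp sg' gg']]] := sg p Mp.
exists (U `&` V), (fun p => f' p *: g' p); split=> //; first exact: openI.
  move=> k; apply: Ck_scale; first exact: openI.
    exact: Ck_sub (@subIsetl _ _ _) (sf' k).
  exact: Ck_sub (@subIsetr _ _ _) (sg' k).
by move=> q Mq [Uq Vq]; rewrite ff' ?gg'.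
Qed.

Lemma smooth_onZ E F (M : set E) (a : R) (f : E -> F) :
  smooth_on M f -> smooth_on M (fun p => a *: f p).
Proof. by move=> sf; apply: smooth_on_scale => //; exact: smooth_on_cst. Qed.

Lemma smooth_onM E (M : set E) (f g : E -> R) :
  smooth_on M f -> smooth_on M g -> smooth_on M (fun p => f p * g p).
Proof. exact: smooth_on_scale. Qed.

Lemma smooth_on_continuous E F (M : set E) (f : E -> F) :
  smooth_on M f -> {within M, continuous f}.
Proof.
move=> sf; apply/subspace_continuousP => p Mp.
have [U [f' [oU Up sf' ff']]] := sf p Mp.
have cf' : f' x @[x --> p] --> f p by rewrite (ff' p)//; exact: (sf' 0%N).
have fE : \forall q \near within M (nbhs p), f' q = f q.
  rewrite near_withinE.
  by apply: filterS (open_nbhs_nbhs (conj oU Up)) => q Uq Mq; rewrite /= ff'.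
apply: cvg_trans; first exact: near_eq_cvg fE.
exact: cvg_within_filter.
Qed.

Lemma curve_on E (M : set E) (p v : E) (c : R -> E) : curve_through M p v c ->
  [/\ M p, c 0 = p, differentiable c 0, 'd c 0 1 = v & \forall s \near 0, M (c s)].
Proof.
move=> [c0 [Dc [U [oU U0 sc McU]]]].
have dc : differentiable c 0 by have [/(_ _ U0)] := sc 1%N.
rewrite -c0 -Dc deriveE//; split=> //; first exact: McU.
exact: filterS (open_nbhs_nbhs (conj oU U0)).
Qed.

(* [tangent_deriv M v f p] is [dir_deriv] for vector-valued functions, at a
   single tangent vector [v]. *)
Definition tangent_deriv E F (M : set E) (v : E) (f : E -> F) (p : E) : F :=
  get [set l : F | exists2 c : R -> E,
         curve_through M p v c & l = 'D_1 (f \o c) 0].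

(** Every curve with velocity [v] gives the same value, the differential at [p] of a local smooth
    extension of [f], applied to [v]. So the [get] in [tangent_deriv] does not depend on a
    choice. *)
Lemma tangent_derivP E F (M : set E) (v : E) (f : E -> F) (p : E) (c : R -> E) :
  smooth_on M f -> curve_through M p v c ->
  is_derive (0 : R) 1 (f \o c) (tangent_deriv M v f p).
Proof.
move=> sf cv; have [Mp _ _ _ _] := curve_on cv.
have [U [f' [oU Up sf' ff']]] := sf p Mp.
have df' : differentiable f' p by have [/(_ _ Up)] := sf' 1%N.
have key c' : curve_through M p v c' -> is_derive (0 : R) 1 (f \o c') ('d f' p v).
  move=> /curve_on[_ c0 dc <- Mc].
  have E' : \forall s \near (0 : R), (f' \o c') s = (f \o c') s.
    have Uc : \forall s \near (0 : R), U (c' s).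
      apply: differentiable_continuous dc _ _; rewrite c0.
      exact: open_nbhs_nbhs.
    by apply: filterS2 Mc Uc => s Ms Us /=; rewrite ff'.
  have dfc : differentiable (f' \o c') 0 by apply: differentiable_comp; rewrite ?c0.
  apply: near_eq_is_derive E' _.
  apply: DeriveDef; first exact: diff_derivable.
  by rewrite deriveE// diff_comp ?c0.
have -> : tangent_deriv M v f p = 'd f' p v.
  apply: get_unique; last by move=> l [c' /key[_ <-]].
  by exists c => //; have [_ ->] := key c cv.
exact: key.
Qed.

Section rules.
Context {E F : normedModType R} {M : set E} {p v : E} (Tv : tangent M p v).

Lemma tangent_derivE (f : E -> F) (l : F) : smooth_on M f ->
  (forall c, curve_through M p v c -> 'D_1 (f \o c) 0 = l) ->
  tangent_deriv M v f p = l.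
Proof.
move=> sf fl; have [c cv] := Tv.
by have [_ <-] := tangent_derivP sf cv; exact: fl.
Qed.

Lemma tangent_deriv_eq (f g : E -> F) : smooth_on M f ->
  (forall q, M q -> f q = g q) ->
  tangent_deriv M v f p = tangent_deriv M v g p.
Proof.
move=> sf fg; apply: tangent_derivE => // c cv.
have sg := smooth_on_eq fg sf.
have [_ _ _ _ Mc] := curve_on cv.
have [_ <-] := tangent_derivP sg cv.
by apply: near_eq_derive; apply: filterS Mc => s /fg.
Qed.

Lemma tangent_deriv_cst (a : F) : tangent_deriv M v (fun=> a) p = 0.
Proof. by apply: tangent_derivE (smooth_on_cst M _) _ => c _; exact: derive_cst. Qed.

Lemma tangent_derivD (f g : E -> F) : smooth_on M f -> smooth_on M g ->
  tangent_deriv M v (fun q => f q + g q) p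
    = tangent_deriv M v f p + tangent_deriv M v g p.
Proof.
move=> sf sg; apply: tangent_derivE; first exact: smooth_on_add.
move=> c cv; by have [] := is_deriveD (tangent_derivP sf cv) (tangent_derivP sg cv).
Qed.

Lemma tangent_deriv_scale (f : E -> R) (g : E -> F) :
  smooth_on M f -> smooth_on M g ->
  tangent_deriv M v (fun q => f q *: g q) p
    = tangent_deriv M v f p *: g p + f p *: tangent_deriv M v g p.
Proof.
move=> sf sg; apply: tangent_derivE; first exact: smooth_on_scale.
move=> c cv; have [df fE] := tangent_derivP sf cv.
have [dg gE] := tangent_derivP sg cv.
have [_ c0 _ _ _] := curve_on cv.
have [_] := differentiable_scale ((derivable1_diffP _ _).1 df)
  ((derivable1_diffP _ _).1 dg).
by move=> /(_ 1); rewrite fE gE /= c0.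
Qed.

Lemma tangent_deriv_lin (G : normedModType R) (L : F -> G) (f : E -> F) :
  linear L -> continuous L -> smooth_on M f ->
  tangent_deriv M v (fun q => L (f q)) p = L (tangent_deriv M v f p).
Proof.
move=> linL Lc sf; have [c cv] := Tv.
have [df fE] := tangent_derivP sf cv.
have [_ lE] := tangent_derivP (smooth_on_lin linL Lc sf) cv.
rewrite -lE -fE; have dL q := linear_diff q linL Lc.
have {}df := (derivable1_diffP _ _).1 df.
rewrite !deriveE//; last exact: differentiable_comp df (dL _).1.
by rewrite (diff_comp df (dL _).1) /= (dL _).2.
Qed.

End rules.

Lemma tangent_deriv_id E (M : set E) (p v : E) : tangent M p v ->
  tangent_deriv M v id p = v.
Proof.
move=> Tv; apply: (tangent_derivE Tv) => [|c cv]; first exact: smooth_on_id.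
by have [_ _ dc <- _] := curve_on cv; rewrite deriveE.
Qed.

Lemma tangent_derivM E (M : set E) (p v : E) (f g : E -> R) : tangent M p v ->
  smooth_on M f -> smooth_on M g ->
  tangent_deriv M v (fun q => f q * g q) p
    = tangent_deriv M v f p * g p + f p * tangent_deriv M v g p.
Proof. by move=> Tv; exact: tangent_deriv_scale. Qed.

End SmoothOn.

Arguments smooth_on_cst {R E F} M a.
Arguments smooth_on_id {R E} M.

(** * Tangent vectors of the product *)

Section AmbientForm.
Context {R : realType} {kappa : R}.
Local Notation B := (ambient_form kappa).
Implicit Types u v w : 'rV[R]_3.

Lemma ambient_formC u v : B u v = B v u.
Proof. by rewrite /ambient_form; ring. Qed.

Lemma ambient_formDl u v w : B (u + v) w = B u w + B v w.
Proof. by rewrite /ambient_form !mxE; ring. Qed.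

Lemma ambient_formZl (a : R) u v : B (a *: u) v = a * B u v.
Proof. by rewrite /ambient_form !mxE; ring. Qed.

Lemma ambient_formDr u v w : B u (v + w) = B u v + B u w.
Proof. by rewrite /ambient_form !mxE; ring. Qed.

Lemma ambient_formZr (a : R) u v : B u (a *: v) = a * B u v.
Proof. by rewrite /ambient_form !mxE; ring. Qed.

Lemma ambient_formNl u v : B (- u) v = - B u v.
Proof. by rewrite /ambient_form !mxE; ring. Qed.

Lemma ambient_formNr u v : B u (- v) = - B u v.
Proof. by rewrite /ambient_form !mxE; ring. Qed.

Lemma ambient_form0r u : B u 0 = 0.
Proof. by rewrite /ambient_form !mxE; ring. Qed.

Lemma ambient_form0l u : B 0 u = 0.
Proof. by rewrite ambient_formC ambient_form0r. Qed.

Definition ambient_formE := (ambient_formDl, ambient_formDr, ambient_formZl,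
  ambient_formZr, ambient_formNl, ambient_formNr, ambient_form0l, ambient_form0r).

Lemma coord_linear (i : 'I_3) : linear (fun u : 'rV[R]_3 => u 0 i).
Proof. by move=> a u v; rewrite !mxE. Qed.

Lemma smooth_on_coord (E : normedModType R) (M : set E) (i : 'I_3)
    (f : E -> 'rV[R]_3) : smooth_on M f -> smooth_on M (fun q => f q 0 i).
Proof.
apply: (smooth_on_lin (L := fun u : 'rV[R]_3 => u 0 i) (coord_linear i)).
exact: coord_continuous.
Qed.

Lemma smooth_on_ambient (E : normedModType R) (M : set E)
    (f g : E -> 'rV[R]_3) :
  smooth_on M f -> smooth_on M g -> smooth_on M (fun q => B (f q) (g q)).
Proof.
move=> sf sg; rewrite /ambient_form.
have sfg i : smooth_on M (fun q => f q 0 i * g q 0 i).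
  by apply: smooth_onM; exact: smooth_on_coord.
apply: smooth_on_add; first exact: smooth_on_add.
by apply: (smooth_onM (f := fun=> Num.sg kappa)) => //; exact: smooth_on_cst.
Qed.

Lemma tangent_deriv_ambient (E : normedModType R) (M : set E) (p v : E)
    (f g : E -> 'rV[R]_3) : tangent M p v ->
  smooth_on M f -> smooth_on M g ->
  tangent_deriv M v (fun q => B (f q) (g q)) p
    = B (tangent_deriv M v f p) (g p) + B (f p) (tangent_deriv M v g p).
Proof.
move=> Tv sf sg; rewrite /ambient_form.
have sc (h : E -> 'rV[R]_3) i : smooth_on M h -> smooth_on M (fun q => h q 0 i).
  exact: smooth_on_coord.
have sM i : smooth_on M (fun q => f q 0 i * g q 0 i).
  by apply: smooth_onM; exact: sc.
have Dc (h : E -> 'rV[R]_3) i : smooth_on M h ->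
    tangent_deriv M v (fun q => h q 0 i) p = tangent_deriv M v h p 0 i.
  move=> sh; apply: (tangent_deriv_lin Tv (L := fun u : 'rV[R]_3 => u 0 i)) => //.
    exact: coord_linear.
  exact: coord_continuous.
have DM i : tangent_deriv M v (fun q => f q 0 i * g q 0 i) p
    = tangent_deriv M v f p 0 i * g p 0 i + f p 0 i * tangent_deriv M v g p 0 i.
  by rewrite tangent_derivM ?Dc//; exact: sc.
have sM2 : smooth_on M (fun q => Num.sg kappa * (f q 0 2 * g q 0 2)).
  by apply: (smooth_onM (f := fun=> Num.sg kappa)) => //; exact: smooth_on_cst.
rewrite (tangent_derivD Tv)//; last exact: smooth_on_add.
rewrite (tangent_derivD Tv)//.
rewrite (tangent_derivM Tv (smooth_on_cst M _))// tangent_deriv_cst// !DM.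
by rewrite mul0r add0r; ring.
Qed.

End AmbientForm.

Section Surface.
Context {R : realType} {kappa : R} (kappa_neq0 : kappa != 0).
Local Notation V := ('rV[R]_3 * R)%type.
Local Notation M := (M3 kappa).
Local Notation B := (ambient_form kappa).
Implicit Types (p q u v w : V) (X Y Z : V -> V).

Lemma M3_form p : M p -> B p.1 p.1 = kappa^-1.
Proof. by case=> [[]]. Qed.

Lemma fst_continuous : continuous (fst : V -> 'rV[R]_3).
Proof. by move=> x; exact: cvg_fst. Qed.

Lemma snd_continuous : continuous (snd : V -> R).
Proof. by move=> x; exact: cvg_snd. Qed.

Lemma smooth_on_fst (N : set V) X : smooth_on N X -> smooth_on N (fun q => (X q).1).
Proof. by apply: (smooth_on_lin (L := fst)) => //; exact: fst_continuous. Qed.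

Lemma smooth_on_snd (N : set V) X : smooth_on N X -> smooth_on N (fun q => (X q).2).
Proof. by apply: (smooth_on_lin (L := snd)) => //; exact: snd_continuous. Qed.

Lemma tangent_deriv_fst (N : set V) p v X : tangent N p v -> smooth_on N X ->
  tangent_deriv N v (fun q => (X q).1) p = (tangent_deriv N v X p).1.
Proof.
by move=> Tv; apply: (tangent_deriv_lin Tv (L := fst)) => //; exact: fst_continuous.
Qed.

Lemma tangent_deriv_snd (N : set V) p v X : tangent N p v -> smooth_on N X ->
  tangent_deriv N v (fun q => (X q).2) p = (tangent_deriv N v X p).2.
Proof.
by move=> Tv; apply: (tangent_deriv_lin Tv (L := snd)) => //; exact: snd_continuous.
Qed.

(** This is the equation B(q, q) = 1 / kappa of the surface, differentiated along [v]. *)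
Lemma tangent_form p v : M p -> tangent M p v -> B p.1 v.1 = 0.
Proof.
move=> Mp Tv; have s1 : smooth_on M (fun q : V => q.1).
  exact: smooth_on_fst (smooth_on_id M).
have := tangent_deriv_cst Tv (kappa^-1).
rewrite -(tangent_deriv_eq Tv (f := fun q : V => B q.1 q.1)); first last.
- by move=> q; exact: M3_form.
- exact: smooth_on_ambient.
rewrite tangent_deriv_ambient// (tangent_deriv_fst Tv (smooth_on_id M)).
rewrite tangent_deriv_id//= [B v.1 _]ambient_formC.
by move=> /eqP; rewrite -mulr2n mulrn_eq0/= => /eqP.
Qed.

(* The curve traces the conic cut out by the plane of [p.1] and [v.1],
   parametrized rationally from [p.1] by stereographic projection; written as
   p + s v + O(s^2), its velocity at 0 is plain. *)
Lemma form_tangent p v : M p -> B p.1 v.1 = 0 -> tangent M p v.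
Proof.
(* By [pv], the form takes the value (1 - a s^2)^2 / kappa + s^2 B(v.1, v.1) on (1 - a s^2) p.1 + s
   v.1. This [a] makes it (1 + a s^2)^2 / kappa, so division by [d s] lands on the surface. *)
move=> Mp pv; pose a := kappa * B v.1 v.1 / 4.
pose d (s : R) := 1 + a * (s * s).
(* [e] is the remainder (c(s) - p - s v) / s^2; the line factor moves at constant speed and adds
   nothing to it. *)
pose e (s : R) : V :=
  (d s)^-1 *: ((- (2 * a)) *: ((p.1, 0) : V) + (- (a * s)) *: ((v.1, 0) : V)).
pose c (s : R) : V := p + (s *: v + s *: (s *: e s)).
(* [x2 s] is [d s] times the third coordinate of the curve; for kappa < 0 its positivity keeps the
   curve on the upper sheet. *)
pose x2 (s : R) := (1 - a * (s * s)) * p.1 0 2 + s * v.1 0 2.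
pose U : set R := [set s | 0 < d s] `&` (if kappa < 0 then [set s | 0 < x2 s] else setT).
have ck_s k N : Ck k N (fun s : R => s) by exact: Ck_id.
have ck_c (F : normedModType R) k N (z : F) : Ck k N (fun s : R => z) by exact: Ck_cst.
have ckM k (N : set R) (f g : R -> R) :
    open N -> Ck k N f -> Ck k N g -> Ck k N (fun s => f s * g s).
  exact: Ck_scale.
have sd k (N : set R) : open N -> Ck k N d.
  by move=> oN; apply: Ck_add => //; apply/ckM => //; exact: ckM.
have sx k (N : set R) : open N -> Ck k N x2.
  move=> oN; apply: Ck_add => //; apply/ckM => //; apply: Ck_add => //.
  apply: (@Ck_lin _ _ _ _ _ _ (-%R)) => //.
  - by move=> z u w; rewrite opprD scalerN.
  - exact: opp_continuous.
  - by apply/ckM => //; exact: ckM.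
have oU : open U.
  have opos (f : R -> R) : Ck 0 setT f -> open [set s | 0 < f s].
    move=> cf; apply: (@open_comp _ _ f [set y | 0 < y]); last exact: open_gt.
    by move=> s _; exact: cf.
  apply: openI; first by apply: opos; exact/sd/openT.
  by case: ifP => _; [apply: opos; exact/sx/openT | exact: openT].
have U0 : U 0.
  split; first by rewrite /= /d !mulr0 addr0.
  case: ifP => // k0; rewrite /= /x2 !mulr0 subr0 mul0r mul1r addr0.
  by case: Mp => [[_ /(_ k0)]].
have se : smooth_in U e.
  move=> k; apply: Ck_scale => //.
    by apply: Ck_inv => // [s [/gt_eqF/negbT]|]//; exact: sd.
  apply: Ck_add => //; apply: Ck_scale => //.
  apply: (@Ck_lin _ _ _ _ _ _ (-%R)) => //.
  - by move=> z u w; rewrite opprD scalerN.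
  - exact: opp_continuous.
  - exact: ckM.
exists c; split; first by rewrite /c !scale0r !addr0.
split; last exists U.
  have de : differentiable e 0 by have [/(_ _ U0)] := se 1%N.
  have der (f : R -> V) : differentiable f 0 -> derivable f 0 1.
    exact: diff_derivable.
  have did : differentiable (fun s : R => s) 0 by [].
  have dcs (z : V) : differentiable (fun _ : R => z) 0 by exact: differentiable_cst.
  have [dsv Dsv] := differentiable_scale did (dcs v).
  have [dse Dse] := differentiable_scale did de.
  have [dsse Dsse] := differentiable_scale did dse.
  have /= D1 := deriveD (der _ dsv) (der _ dsse).
  have dD := differentiableD dsv dsse.
  have /= D2 := deriveD (der _ (dcs p)) (der _ dD).
  rewrite /c D2 D1 Dsv Dsse Dse derive_id !derive_cst.
  by rewrite !scale0r !scaler0 !scale1r !add0r !addr0.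
split => //.
  move=> k; apply: Ck_add => //; apply: Ck_add => //; apply: Ck_scale => //.
  by apply: Ck_scale => //; exact: se.
move=> s [ds xs].
have cE : (c s).1 = (d s)^-1 *: ((1 - a * (s * s)) *: p.1 + s *: v.1).
  apply: (scalerI (lt0r_neq0 ds)); rewrite scalerA divff ?gt_eqF// scale1r.
  rewrite /c /e /=; apply/rowP => i; rewrite !mxE.
  by rewrite /d in ds *; field; rewrite gt_eqF.
split => //; split.
  rewrite cE !ambient_formE (M3_form Mp) pv [B v.1 p.1]ambient_formC pv.
  have -> : B v.1 v.1 = 4 * a / kappa by rewrite /a; field.
  by rewrite /d in ds *; field; rewrite kappa_neq0 gt_eqF.
by move=> k0; rewrite k0 in xs; rewrite cE !mxE mulr_gt0 ?invr_gt0.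
Qed.

End Surface.

(** * Levi-Civita connection and curvature of the product *)

Section Fields.
Context {R : realType} {kappa : R} (kappa_neq0 : kappa != 0).
Local Notation V := ('rV[R]_3 * R)%type.
Local Notation M := (M3 kappa).
Local Notation B := (ambient_form kappa).
Local Notation g := (@g3 R kappa).
Implicit Types (p q u v w : V) (X Y Z : V -> V) (f : V -> R).

Lemma vector_field_add X Y : vector_field M X -> vector_field M Y ->
  vector_field M (fun q => X q + Y q).
Proof.
move=> [sX tX] [sY tY]; split=> [|p Mp]; first exact: smooth_on_add.
apply: form_tangent => //=; rewrite ambient_formDr.
by rewrite (tangent_form Mp (tX _ Mp)) (tangent_form Mp (tY _ Mp)) addr0.
Qed.

Lemma vector_field_scale f X : smooth_on M f -> vector_field M X ->
  vector_field M (fun q => f q *: X q).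
Proof.
move=> sf [sX tX]; split=> [|p Mp]; first exact: smooth_on_scale.
apply: form_tangent => //=; rewrite ambient_formZr.
by rewrite (tangent_form Mp (tX _ Mp)) mulr0.
Qed.

Lemma vector_field_sub X Y : vector_field M X -> vector_field M Y ->
  vector_field M (fun q => X q - Y q).
Proof.
move=> vX vY; have := vector_field_scale (smooth_on_cst M (-1 : R)) vY.
move=> /(vector_field_add vX); congr (vector_field M _).
by apply/funext => q; rewrite scaleN1r.
Qed.

Lemma vector_field_eq X Y : (forall q, M q -> X q = Y q) ->
  vector_field M X -> vector_field M Y.
Proof.
move=> XY [sX tX]; split=> [|p Mp]; first exact: smooth_on_eq sX.
by rewrite -XY//; exact: tX.
Qed.

Lemma vector_field_E3 : vector_field M (@E3 R).
Proof.
split=> [|p Mp]; first exact: smooth_on_cst.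
by apply: form_tangent => //=; rewrite ambient_form0r.
Qed.

Lemma pair0_linear : linear (fun x : 'rV[R]_3 => (x, 0) : V).
Proof.
move=> a x y; rewrite [RHS](_ : _ = (a *: x + y, a *: 0 + 0))//.
by rewrite scaler0 addr0.
Qed.

Lemma pair0_continuous : continuous (fun x : 'rV[R]_3 => (x, 0) : V).
Proof.
by move=> x; apply: differentiable_continuous; exact: differentiable_pair.
Qed.

Lemma smooth_on_fst0 (N : set V) : smooth_on N (fun q => (q.1, 0) : V).
Proof.
exact: (smooth_on_lin pair0_linear pair0_continuous
  (smooth_on_fst (smooth_on_id N))).
Qed.

(** The tangential projection of the constant field [w], since the position (q.1, 0) is normal to M
    with square 1 / kappa. It extends a tangent vector at one point to a field on M, as the axioms
    on fields require. *)
Definition projected_field w : V -> V :=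
  fun q => w - (kappa * B q.1 w.1) *: (q.1, 0).

Lemma vector_field_projected w : vector_field M (projected_field w).
Proof.
have sB : smooth_on M (fun q : V => kappa * B q.1 w.1).
  apply: (smooth_onM (smooth_on_cst M kappa)).
  apply: (smooth_on_ambient (g := fun=> w.1)); last exact: smooth_on_cst.
  exact: smooth_on_fst (smooth_on_id _).
split=> [|p Mp].
  have := smooth_on_add (smooth_on_cst M w) (smooth_onZ (-1)
    (smooth_on_scale sB (smooth_on_fst0 (N := M)))).
  by apply: smooth_on_eq => q _; rewrite scaleN1r.
apply: form_tangent => //=; rewrite !ambient_formE (M3_form Mp).
by field.
Qed.

Lemma projected_field_id p w : B p.1 w.1 = 0 -> projected_field w p = w.
Proof. by move=> pw; rewrite /projected_field pw mulr0 scale0r subr0. Qed.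

Lemma g3E p u v : g p u v = B u.1 v.1 + u.2 * v.2.
Proof. by []. Qed.

Lemma g3C p u v : g p u v = g p v u.
Proof. by rewrite !g3E ambient_formC [u.2 * _]mulrC. Qed.

Lemma g3Dl p u v w : g p (u + v) w = g p u w + g p v w.
Proof. by rewrite !g3E /= ambient_formDl mulrDl addrACA. Qed.

Lemma g3Zl p (a : R) u w : g p (a *: u) w = a * g p u w.
Proof.
have a_u : (a *: u).2 = a * u.2 by [].
by rewrite !g3E a_u ambient_formZl [RHS]mulrDr [a * (u.2 * _)]mulrA.
Qed.

Lemma g3Nl p u w : g p (- u) w = - g p u w.
Proof. by rewrite -scaleN1r g3Zl mulN1r. Qed.

Lemma g3Dr p u v w : g p w (u + v) = g p w u + g p w v.
Proof. by rewrite ![g p w _]g3C g3Dl. Qed.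

Lemma g3Zr p (a : R) u w : g p w (a *: u) = a * g p w u.
Proof. by rewrite ![g p w _]g3C g3Zl. Qed.

Lemma g3Nr p u w : g p w (- u) = - g p w u.
Proof. by rewrite ![g p w _]g3C g3Nl. Qed.

Lemma g3_radial p u : M p -> tangent M p u -> g p (p.1, 0) u = 0.
Proof. by move=> Mp Tu; rewrite g3E /= (tangent_form Mp Tu) mul0r addr0. Qed.

Lemma tangent_deriv_form p v X Y : tangent M p v ->
  smooth_on M X -> smooth_on M Y ->
  tangent_deriv M v (fun q => B (X q).1 (Y q).1) p
    = B (tangent_deriv M v X p).1 (Y p).1 + B (X p).1 (tangent_deriv M v Y p).1.
Proof.
move=> Tv sX sY; rewrite tangent_deriv_ambient//; first last.
- exact: smooth_on_fst.
- exact: smooth_on_fst.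
by rewrite !tangent_deriv_fst.
Qed.

Lemma tangent_deriv_g3 p v X Y : tangent M p v ->
  smooth_on M X -> smooth_on M Y ->
  tangent_deriv M v (fun q => g q (X q) (Y q)) p
    = g p (tangent_deriv M v X p) (Y p) + g p (X p) (tangent_deriv M v Y p).
Proof.
move=> Tv sX sY; rewrite (tangent_derivD Tv (f := fun q => B (X q).1 (Y q).1)
  (g := fun q => (X q).2 * (Y q).2)); first last.
- by apply: smooth_onM; exact: smooth_on_snd.
- by apply: smooth_on_ambient; exact: smooth_on_fst.
rewrite tangent_deriv_form// tangent_derivM//; try exact: smooth_on_snd.
rewrite (tangent_deriv_snd Tv sX) (tangent_deriv_snd Tv sY).
rewrite /g3 /product_metric /space_form_metric.
by rewrite addrACA.
Qed.

Lemma point_ext u v : (forall i, u.1 0 i = v.1 0 i) -> u.2 = v.2 -> u = v.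
Proof.
case: u v => [u1 u2] [v1 v2] /= uv ->; congr pair; apply/rowP => i; exact: uv.
Qed.

(** The torsion axiom speaks of scalar functions; continuous linear functionals turn it into
    identities between vectors. *)
Lemma linear_ext u v :
  (forall L : V -> R, linear L -> continuous L -> L u = L v) -> u = v.
Proof.
move=> key; apply: point_ext => [i|]; last first.
  by apply: (key snd) => //; exact: snd_continuous.
apply: (key (fun u => u.1 0 i)); first by move=> a x y; rewrite !mxE.
move=> x; exact: (continuous_comp (@fst_continuous R x)
  (@coord_continuous _ _ _ 0 i x.1)).
Qed.

Lemma linear_sub (L : V -> R) u v : linear L -> L (u - v) = L u - L v.
Proof. by move=> linL; rewrite addrC -scaleN1r linL scaleN1r addrC. Qed.

Lemma tangent_deriv_fst0 p v : tangent M p v ->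
  tangent_deriv M v (fun q => (q.1, 0) : V) p = (v.1, 0).
Proof.
move=> Tv; have sf := smooth_on_fst (smooth_on_id M).
rewrite (tangent_deriv_lin Tv pair0_linear pair0_continuous sf).
by rewrite (tangent_deriv_fst Tv (smooth_on_id M)) tangent_deriv_id.
Qed.

End Fields.

Section LeviCivita.
Context {R : realType} {kappa : R} (kappa_neq0 : kappa != 0).
Local Notation V := ('rV[R]_3 * R)%type.
Local Notation M := (M3 kappa).
Local Notation B := (ambient_form kappa).
Local Notation g := (@g3 R kappa).
Context (nabla : (V -> V) -> (V -> V) -> V -> V).
Hypothesis nabla_LC : levi_civita M g nabla.
Hypothesis g_metric : riemannian_metric M g.
Implicit Types (p q u v w : V) (X Y Z : V -> V) (f : V -> R).

Let nabla_field := connection_field (levi_civita_connection nabla_LC).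

(* Taking coordinate functions for [f] in the torsion axiom. *)
Lemma torsion_vector X Y p : vector_field M X -> vector_field M Y -> M p ->
  nabla X Y p - nabla Y X p
    = tangent_deriv M (X p) Y p - tangent_deriv M (Y p) X p.
Proof.
move=> vX vY Mp; have [[sX tX] [sY tY]] := (vX, vY).
have [sN tN] := vector_field_sub kappa_neq0 (nabla_field vX vY) (nabla_field vY vX).
apply: linear_ext => L linL Lc.
have sL : smooth_on M L by exact: (smooth_on_lin linL Lc (smooth_on_id M)).
have dL Z q : vector_field M Z -> M q -> dir_deriv M Z L q = L (Z q).
  move=> [sZ tZ] Mq.
  have := tangent_deriv_lin (tZ _ Mq) linL Lc (smooth_on_id M).
  by rewrite tangent_deriv_id//; exact: tZ.
have := levi_civita_torsion nabla_LC vX vY sL Mp.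
rewrite dL// => ->.
have dd Z W : vector_field M Z -> vector_field M W ->
    dir_deriv M Z (dir_deriv M W L) p = L (tangent_deriv M (Z p) W p).
  move=> [sZ tZ] vW; rewrite -(tangent_deriv_lin (tZ _ Mp) linL Lc vW.1).
  apply/esym/(tangent_deriv_eq (tZ _ Mp) (smooth_on_lin linL Lc vW.1)).
  by move=> q Mq; rewrite dL.
by rewrite !dd// linear_sub.
Qed.

(* The right-hand side is the tangential part of the flat derivative. The
   difference of the two sides is symmetric in X, Y because both are
   torsion-free, and <difference(X, Y), Z> is skew in Y, Z because both are
   metric; such a trilinear expression vanishes. *)
Lemma nablaE X Y p : vector_field M X -> vector_field M Y -> M p ->
  nabla X Y p = tangent_deriv M (X p) Y p + (kappa * B (X p).1 (Y p).1) *: (p.1, 0).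
Proof.
move=> + + Mp.
pose A X Y := nabla X Y p - tangent_deriv M (X p) Y p
  - (kappa * B (X p).1 (Y p).1) *: (p.1, 0).
have A1 X' Y' : (A X' Y').1 = (nabla X' Y' p).1 - (tangent_deriv M (X' p) Y' p).1
    - (kappa * B (X' p).1 (Y' p).1) *: p.1 by [].
have A2 X' Y' : (A X' Y').2 = (nabla X' Y' p).2 - (tangent_deriv M (X' p) Y' p).2.
  have := subr0 ((nabla X' Y' p).2 - (tangent_deriv M (X' p) Y' p).2).
  by rewrite -[X in _ - X](mulr0 (kappa * B (X' p).1 (Y' p).1)).
have Asym X' Y' : vector_field M X' -> vector_field M Y' -> A X' Y' = A Y' X'.
  move=> vX vY; have := torsion_vector vX vY Mp.
  rewrite /A [B (Y' p).1 _]ambient_formC.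
  have swap (a b c d : V) : a - b = c - d -> a - c = b - d.
    by move=> /(canRL (subrK _)) ->; rewrite addrAC [c - d]addrC addrK addrC.
  by move=> /swap ->.
(* Differentiating B(q, Y) = 0 along X gives B(p, D_X Y) = - B(X, Y), and B(p, p) = 1 / kappa then
   explains the factor kappa of the radial term. Tangency of A matters because the metric is
   positive on tangent vectors, while the ambient form may be indefinite. *)
have Atan X' Y' : vector_field M X' -> vector_field M Y' -> B p.1 (A X' Y').1 = 0.
  move=> vX vY; have [[sX tX] [sY tY]] := (vX, vY).
  rewrite A1 !ambient_formE (M3_form Mp).
  rewrite (tangent_form Mp ((nabla_field vX vY).2 p Mp)).
  have := tangent_deriv_cst (tX _ Mp) (0 : R).
  rewrite -(tangent_deriv_eq (tX _ Mp) (f := fun q : V => B q.1 (Y' q).1)); first last.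
  - by move=> q Mq; exact: tangent_form (tY _ Mq).
  - by apply: smooth_on_ambient; apply: smooth_on_fst => //; exact: smooth_on_id.
  rewrite (tangent_deriv_form (tX _ Mp) (smooth_on_id M))//.
  rewrite tangent_deriv_id; last exact: tX.
  by move=> /eqP; rewrite addrC addr_eq0 => /eqP ->; field.
have Aanti X' Y' Z' : vector_field M X' -> vector_field M Y' -> vector_field M Z' ->
    g p (A X' Y') (Z' p) + g p (Y' p) (A X' Z') = 0.
  move=> vX vY vZ; have [[sX tX] [[sY tY] [sZ tZ]]] := (vX, (vY, vZ)).
  have := levi_civita_metric nabla_LC vX vY vZ Mp.
  rewrite [LHS](tangent_deriv_g3 (tX _ Mp) sY sZ) => E0.
  rewrite /A !g3Dl !g3Dr !g3Nl !g3Nr g3Zl g3Zr.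
  rewrite [g p (Y' p) (p.1, 0)]g3C !g3_radial//; [|exact: tZ|exact: tY].
  by rewrite !mulr0 !subr0 addrACA -opprD E0 subrr.
move=> vX vY.
have A0 Z' : vector_field M Z' -> g p (A X Y) (Z' p) = 0.
  move=> vZ.
  (* After the symmetries, the three skew relations read a + b = a + c = b + c = 0. *)
  have := Aanti _ _ _ vX vY vZ; have := Aanti _ _ _ vY vX vZ.
  have := Aanti _ _ _ vZ vX vY.
  rewrite (Asym _ _ vY vX) (Asym _ _ vZ vX) (Asym _ _ vZ vY).
  rewrite ![g p (X p) _]g3C ![g p (Y p) _]g3C.
  move: (g p (A X Y) _) (g p (A X Z') _) (g p (A Y Z') _) => a b c; lra.
(* A(X, Y) is paired with itself, extended to a field by projection. *)
have /eqP : A X Y == 0.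
  apply/negPn/negP => A_neq0.
  have TA : tangent M p (A X Y) by apply: form_tangent => //; exact: Atan.
  have := metric_pos g_metric Mp TA A_neq0.
  have := A0 _ (vector_field_projected kappa_neq0 (A X Y)).
  by rewrite projected_field_id ?Atan// => ->; rewrite ltxx.
by rewrite /A -addrA -opprD => /eqP; rewrite subr_eq0 => /eqP.
Qed.

(** The axioms do not state that [nabla] ignores values off M; for the differentiated field this is
    read off from [nablaE]. *)
Lemma nabla_eq X Y Z p : vector_field M X -> vector_field M Y -> M p ->
  (forall q, M q -> Y q = Z q) -> nabla X Y p = nabla X Z p.
Proof.
move=> vX vY Mp YZ; rewrite !nablaE//; last exact: vector_field_eq vY.
by rewrite (tangent_deriv_eq (vX.2 p Mp) vY.1 YZ) YZ.
Qed.

Lemma nabla_cst X p v : vector_field M X -> vector_field M (fun=> v) -> M p -> v.1 = 0 ->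
  nabla X (fun=> v) p = 0.
Proof.
move=> vX vv Mp v0; rewrite nablaE// v0 ambient_form0r mulr0 scale0r addr0.
exact: tangent_deriv_cst (vX.2 p Mp) _.
Qed.

(* The torsion axiom on the coordinate functions of [Z] makes flat second
   derivatives commute, so no symmetry of second derivatives in the ambient
   space has to be proved. *)
Lemma torsion_deriv X Y Z W W' p : vector_field M X -> vector_field M Y ->
  smooth_on M Z -> smooth_on M W -> smooth_on M W' -> M p ->
  (forall q, M q -> W q = tangent_deriv M (Y q) Z q) ->
  (forall q, M q -> W' q = tangent_deriv M (X q) Z q) ->
  tangent_deriv M (nabla X Y p - nabla Y X p) Z p
    = tangent_deriv M (X p) W p - tangent_deriv M (Y p) W' p.
Proof.
move=> vX vY sZ sW sW' Mp WE WE'; apply: linear_ext => L linL Lc.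
have [_ tN] := vector_field_sub kappa_neq0 (nabla_field vX vY) (nabla_field vY vX).
rewrite -(tangent_deriv_lin (tN _ Mp) linL Lc sZ) linear_sub//.
have := levi_civita_torsion nabla_LC vX vY (smooth_on_lin linL Lc sZ) Mp.
rewrite [LHS](_ : _ = tangent_deriv M (nabla X Y p - nabla Y X p) (L \o Z) p)// => ->.
have dd X' Y' U : vector_field M X' -> vector_field M Y' -> smooth_on M U ->
    (forall q, M q -> U q = tangent_deriv M (Y' q) Z q) ->
    dir_deriv M X' (dir_deriv M Y' (L \o Z)) p = L (tangent_deriv M (X' p) U p).
  move=> [_ tX'] [_ tY'] sU UE; rewrite -(tangent_deriv_lin (tX' _ Mp) linL Lc sU).
  apply/esym/(tangent_deriv_eq (tX' _ Mp) (smooth_on_lin linL Lc sU)) => q Mq.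
  by rewrite UE// -(tangent_deriv_lin (tY' _ Mq) linL Lc sZ).
by rewrite (dd _ _ W)// (dd _ _ W').
Qed.

(** [W] is the flat derivative D_Y Z written through [nabla], which makes it visibly smooth, so that
    it can be differentiated again. In the radial coefficient only B(nabla_X Y, Z) is affected by
    exchanging X and Y; the other two terms trade places. *)
Lemma flat_second_deriv X Y Z p (W := fun q : V =>
    nabla Y Z q - (kappa * B (Y q).1 (Z q).1) *: ((q.1, 0) : V)) :
  vector_field M X -> vector_field M Y -> vector_field M Z -> M p ->
  [/\ smooth_on M W, forall q, M q -> W q = tangent_deriv M (Y q) Z q &
    tangent_deriv M (X p) W p = nabla X (nabla Y Z) p
      - (kappa * (B (X p).1 (nabla Y Z p).1 + B (nabla X Y p).1 (Z p).1
                  + B (Y p).1 (nabla X Z p).1)) *: (p.1, 0)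
      - (kappa * B (Y p).1 (Z p).1) *: ((X p).1, 0)].
Proof.
move=> vX vY vZ Mp; have [[sX tX] [sY tY] [sZ tZ]] := And3 vX vY vZ.
have vYZ := nabla_field vY vZ.
have sB : smooth_on M (fun q => B (Y q).1 (Z q).1).
  by apply: smooth_on_ambient; exact: smooth_on_fst.
have sK : smooth_on M (fun q => - (kappa * B (Y q).1 (Z q).1)).
  have := smooth_onZ (- kappa) sB; apply: smooth_on_eq => q _.
  exact: mulNr.
have sr : smooth_on M (fun q => - (kappa * B (Y q).1 (Z q).1) *: ((q.1, 0) : V)).
  exact: smooth_on_scale sK (smooth_on_fst0 (N := M)).
have WE : W = fun q => nabla Y Z q + - (kappa * B (Y q).1 (Z q).1) *: ((q.1, 0) : V).
  by apply/funext => q; rewrite scaleNr.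
(* [nabla] may replace the flat derivatives here: they differ by radial vectors, which are
   orthogonal to the tangent vectors Y and Z. *)
have DK : tangent_deriv M (X p) (fun q => - (kappa * B (Y q).1 (Z q).1)) p
    = - (kappa * (B (nabla X Y p).1 (Z p).1 + B (Y p).1 (nabla X Z p).1)).
  rewrite (tangent_deriv_lin (tX _ Mp) (L := fun x : R => - (kappa * x))) //; first last.
  - by move=> x; apply: cvgN; apply: cvgMr; exact: cvg_id.
  - by move=> a x y; rewrite mulrDr opprD mulrCA scalerN.
  rewrite (tangent_deriv_form (tX _ Mp) sY sZ) !nablaE//=.
  rewrite !ambient_formE (tangent_form Mp (tZ _ Mp)) [B (Y p).1 p.1]ambient_formC.
  by rewrite (tangent_form Mp (tY _ Mp)) !mulr0 !addr0.
split.
- by rewrite WE; exact: smooth_on_add vYZ.1 sr.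
- by move=> q Mq; rewrite /W nablaE// addrK.
- rewrite WE (tangent_derivD (tX _ Mp) vYZ.1 sr).
  rewrite (tangent_deriv_scale (tX _ Mp) sK (smooth_on_fst0 (N := M))) DK.
  rewrite (tangent_deriv_fst0 (tX _ Mp)) (nablaE vX vYZ Mp).
  move: (B (X p).1 (nabla Y Z p).1) (B (nabla X Y p).1 (Z p).1).
  move: (B (Y p).1 (nabla X Z p).1) (B (Y p).1 (Z p).1) => a b c d.
  rewrite -[c + d + a]addrA [in RHS]mulrDr [in RHS]scalerDl [in RHS]opprD.
  by rewrite !addrA addrK !scaleNr.
Qed.

(** Gauss equation: flat derivatives commute up to the bracket, so what survives comes from
    differentiating the position q in the radial term kappa B(Y, Z) q. The radial remainder cancels
    against that of [nabla] along the bracket. *)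
Lemma curvatureE X Y Z p :
  vector_field M X -> vector_field M Y -> vector_field M Z -> M p ->
  nabla X (nabla Y Z) p - nabla Y (nabla X Z) p
    - nabla (fun q => nabla X Y q - nabla Y X q) Z p
  = (kappa * B (Y p).1 (Z p).1) *: ((X p).1, 0)
    - (kappa * B (X p).1 (Z p).1) *: ((Y p).1, 0).
Proof.
move=> vX vY vZ Mp; have vXY := nabla_field vX vY; have vYX := nabla_field vY vX.
have [sW WE DW] := flat_second_deriv vX vY vZ Mp.
have [sW' WE' DW'] := flat_second_deriv vY vX vZ Mp.
have := torsion_deriv vX vY vZ.1 sW sW' Mp WE WE'.
rewrite {}DW {}DW' (nablaE (vector_field_sub kappa_neq0 vXY vYX) vZ Mp) /=.
rewrite ambient_formDl ambient_formNl => ->.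
move: (_ *: ((X p).1, 0)) (_ *: ((Y p).1, 0)) => s t.
move: (nabla X (nabla Y Z) p) (nabla Y (nabla X Z) p) => P Q.
move: (B (nabla X Y p).1 _) (B (nabla Y X p).1 _) (B (X p).1 _) (B (Y p).1 _).
move=> a b c d; apply: point_ext => [i|]; rewrite /= ?mxE; ring.
Qed.

End LeviCivita.

(** * Trans-Sasakian structures *)

Section TransSasakian.
Context {R : realType} {kappa : R} (kappa_neq0 : kappa != 0).
Local Notation V := ('rV[R]_3 * R)%type.
Local Notation M := (M3 kappa).
Local Notation B := (ambient_form kappa).
Local Notation g := (@g3 R kappa).
Context (nabla : (V -> V) -> (V -> V) -> V -> V).
Hypothesis nabla_LC : levi_civita M g nabla.
Context (phi : V -> V -> V) (xi : V -> V) (eta : V -> V -> R) (alpha beta : V -> R).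
Hypothesis structure : trans_sasakian M nabla phi xi eta g alpha beta.
Implicit Types (p q u v w : V) (X Y Z : V -> V) (f : V -> R).

Let acm := trans_sasakian_acm structure.
Let phiT := acm_phi acm.
Let vxi := acm_xi acm.
Let g_metric := acm_g acm.
Let nabla_conn := levi_civita_connection nabla_LC.

Lemma tangent_lin p u v (a : R) : M p -> tangent M p u -> tangent M p v ->
  tangent M p (a *: u + v).
Proof.
move=> Mp Tu Tv; apply: form_tangent => //=.
by rewrite !ambient_formE (tangent_form Mp Tu) (tangent_form Mp Tv) mulr0 addr0.
Qed.

Lemma tangent0 p : M p -> tangent M p 0.
Proof. by move=> Mp; apply: form_tangent => //=; rewrite ambient_form0r. Qed.

Lemma tangentZ p u (a : R) : M p -> tangent M p u -> tangent M p (a *: u).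
Proof.
move=> Mp Tu; have := tangent_lin a Mp Tu (tangent0 Mp).
by rewrite addr0.
Qed.

(** * Algebra of the structure at a single point *)

Section Pointwise.
Context (p : V) (Mp : M p).

Let Txi : tangent M p (xi p). Proof. exact: vxi.2. Qed.

Lemma phi0 : phi p 0 = 0.
Proof.
have := tensor11_linear phiT (-1) Mp (tangent0 Mp) (tangent0 Mp).
by rewrite scaler0 addr0 scaleN1r addNr.
Qed.

Lemma phiZ (a : R) u : tangent M p u -> phi p (a *: u) = a *: phi p u.
Proof.
move=> Tu; have := tensor11_linear phiT a Mp Tu (tangent0 Mp).
by rewrite !addr0 phi0 addr0.
Qed.

Lemma g3_0r u : g p u 0 = 0.
Proof. by rewrite g3E ambient_form0r mulr0 addr0. Qed.

Lemma eta_g u : tangent M p u -> eta p u = g p u (xi p).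
Proof.
move=> Tu; have := acm_compat acm Mp Tu Txi.
rewrite (acm_phi_xi acm Mp) (acm_eta_xi acm Mp) mulr1 g3_0r.
by move/esym/eqP; rewrite subr_eq0 => /eqP.
Qed.

Lemma phi_tangent u : tangent M p u -> tangent M p (phi p u).
Proof. exact: (tensor11_tangent phiT). Qed.

Lemma g_phi_xi u : tangent M p u -> g p (phi p u) (xi p) = 0.
Proof.
by move=> Tu; rewrite -eta_g; [exact: (acm_eta_phi acm) | exact: phi_tangent].
Qed.

(** Compatibility is applied to u and phi v, where phi(phi v) = - v + eta(v) xi and phi u is
    orthogonal to xi. *)
Lemma g_phi_skew u v : tangent M p u -> tangent M p v ->
  g p (phi p u) v = - g p u (phi p v).
Proof.
move=> Tu Tv; have := acm_compat acm Mp Tu (phi_tangent Tv).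
rewrite (acm_phi2 acm Mp Tv) (acm_eta_phi acm Mp Tv) mulr0 subr0.
by rewrite g3Dr g3Nr g3Zr (g_phi_xi Tu) mulr0 addr0 => <-; rewrite opprK.
Qed.

Lemma g_phi_id u : tangent M p u -> g p (phi p u) u = 0.
Proof.
move=> Tu; have /eqP := g_phi_skew Tu Tu.
by rewrite [g p u _]g3C -subr_eq0 opprK -mulr2n mulrn_eq0/= => /eqP.
Qed.

Lemma g_xi_xi : g p (xi p) (xi p) = 1.
Proof. by rewrite -eta_g// (acm_eta_xi acm Mp). Qed.

End Pointwise.

(** * Covariant derivatives of [xi] and along [xi] *)

Lemma vector_field_phi X : vector_field M X -> vector_field M (fun q => phi q (X q)).
Proof.
move=> vX; split; first exact: (tensor11_smooth phiT vX).
by move=> p Mp; apply: (tensor11_tangent phiT Mp); exact: vX.2.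
Qed.

Lemma g_nabla_xi_xi X p : vector_field M X -> M p -> g p (nabla X xi p) (xi p) = 0.
Proof.
move=> vX Mp; have := levi_civita_metric nabla_LC vX vxi vxi Mp.
rewrite [LHS](_ : _ = 0); last first.
  rewrite -(tangent_deriv_cst (vX.2 p Mp) (1 : R)).
  apply/esym/tangent_deriv_eq; [exact: vX.2 | exact: smooth_on_cst |].
  by move=> q Mq; rewrite g_xi_xi.
by move/esym/eqP; rewrite [g p (xi p) _]g3C -mulr2n mulrn_eq0/= => /eqP.
Qed.

(** For Y = xi the defining equation yields phi(nabla_X xi), because phi xi = 0. Another application
    of phi recovers nabla_X xi, which is orthogonal to the unit field xi. *)
Lemma nabla_xiE X p : vector_field M X -> M p ->
  nabla X xi p = - alpha p *: phi p (X p)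
    + (beta p *: X p + - (beta p * eta p (X p)) *: xi p).
Proof.
move=> vX Mp; have TX := vX.2 p Mp; have Txi := vxi.2 p Mp.
have TN : tangent M p (nabla X xi p) := (connection_field nabla_conn vX vxi).2 p Mp.
have := trans_sasakian_eq structure vX vxi Mp.
have -> : nabla X (fun q => phi q (xi q)) p = 0.
  have v0 : vector_field M (fun=> 0).
    by split=> [|q Mq]; [exact: smooth_on_cst | exact: tangent0].
  rewrite -(nabla_cst kappa_neq0 nabla_LC g_metric vX v0 Mp (erefl _)).
  apply: (nabla_eq kappa_neq0 nabla_LC g_metric vX) => //.
    exact: vector_field_phi.
  by move=> q Mq; rewrite (acm_phi_xi acm Mq).
rewrite -(eta_g Mp TX) (g_phi_xi Mp TX) (acm_eta_xi acm Mp) !scale1r scale0r.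
rewrite sub0r sub0r => E.
have := acm_phi2 acm Mp TN; rewrite (eta_g Mp TN) g_nabla_xi_xi// scale0r addr0.
move=> /(congr1 -%R); rewrite opprK => <-.
have -> : phi p (nabla X xi p)
    = alpha p *: X p + (beta p *: phi p (X p) + - (alpha p * eta p (X p)) *: xi p).
  rewrite -[LHS]opprK E opprD scalerN opprK -scalerN opprB scalerBr scalerA.
  by rewrite scaleNr addrAC addrA.
have T1 := phi_tangent Mp TX.
rewrite (tensor11_linear phiT _ Mp TX); last first.
  by apply: tangent_lin => //; exact: tangentZ.
rewrite (tensor11_linear phiT _ Mp T1); last first.
  exact: tangentZ.
rewrite (phiZ Mp _ Txi) (acm_phi_xi acm Mp) scaler0 addr0 (acm_phi2 acm Mp TX).
by rewrite opprD scalerDr scalerN opprD opprK scalerA !scaleNr.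
Qed.

Lemma nabla_xi_xi p : M p -> nabla xi xi p = 0.
Proof.
move=> Mp; rewrite nabla_xiE// (acm_phi_xi acm Mp) (acm_eta_xi acm Mp).
by rewrite scaler0 add0r mulr1 scaleNr subrr.
Qed.

(** In the direction xi both brackets of the trans-Sasakian equation vanish, by g(xi, Y) = eta(Y)
    and phi xi = 0. *)
Lemma nabla_xi_phi X p : vector_field M X -> M p ->
  nabla xi (fun q => phi q (X q)) p = phi p (nabla xi X p).
Proof.
move=> vX Mp; have TX := vX.2 p Mp.
have := trans_sasakian_eq structure vxi vX Mp.
rewrite (acm_phi_xi acm Mp) (eta_g Mp TX) [g p (xi p) _]g3C subrr.
rewrite !scaler0 subr0 [g p 0 _]g3C g3_0r scale0r scaler0 addr0.
by move/eqP; rewrite subr_eq0 => /eqP.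
Qed.

(* By [curvatureE] the left-hand side is <R(X, xi)xi, u>. *)
Lemma curvature_xi p : M p -> exists l m : R, forall X u,
  vector_field M X -> tangent M p u -> g p (xi p) u = 0 ->
  kappa * (B (xi p).1 (xi p).1 * B (X p).1 u.1 - B (X p).1 (xi p).1 * B (xi p).1 u.1)
  = l * g p (X p) u + m * g p (phi p (X p)) u.
Proof.
move=> Mp.
(* In R(X, xi)xi, the derivatives of alpha and beta come from nabla_xi nabla_X xi and the quadratic
   terms from [nabla] along the bracket; the terms in nabla_xi X cancel. The derivative stays on -
   alpha, the coefficient to which the Leibniz rule is applied. *)
exists (alpha p ^+ 2 - beta p ^+ 2 - dir_deriv M xi beta p).
exists (2 * alpha p * beta p - dir_deriv M xi (fun q => - alpha q) p).
move=> X u vX Tu xi_u.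
have TX := vX.2 p Mp; have Txi := vxi.2 p Mp.
have vphiX := vector_field_phi vX.
have vNX := connection_field nabla_conn vxi vX.
have vNxi := connection_field nabla_conn vX vxi.
have sNa : smooth_on M (fun q => - alpha q).
  have := smooth_onZ (-1) (trans_sasakian_alpha structure).
  by apply: smooth_on_eq => q _; exact: mulN1r.
have sb := trans_sasakian_beta structure.
have sbe : smooth_on M (fun q => - (beta q * eta q (X q))).
  have := smooth_onZ (-1) (smooth_onM sb (one_form_smooth (acm_eta acm) vX)).
  by apply: smooth_on_eq => q _; exact: mulN1r.
have va := vector_field_scale kappa_neq0 sNa vphiX.
have vb := vector_field_scale kappa_neq0 sb vX.
have vbe := vector_field_scale kappa_neq0 sbe vxi.
have := curvatureE kappa_neq0 nabla_LC g_metric vX vxi vxi Mp.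
have -> : nabla X (nabla xi xi) p = 0.
  have v0 : vector_field M (fun=> 0).
    by split=> [|q Mq]; [exact: smooth_on_cst | exact: tangent0].
  rewrite -(nabla_cst kappa_neq0 nabla_LC g_metric vX v0 Mp (erefl _)).
  apply: (nabla_eq kappa_neq0 nabla_LC g_metric vX) => //.
    exact: (connection_field nabla_conn vxi vxi).
  by move=> q Mq; rewrite nabla_xi_xi.
rewrite (nabla_eq kappa_neq0 nabla_LC g_metric vxi vNxi Mp (fun q Mq => nabla_xiE vX Mq)).
rewrite (connection_additive nabla_conn vxi va (vector_field_add kappa_neq0 vb vbe) Mp).
rewrite (connection_additive nabla_conn vxi vb vbe Mp).
rewrite (connection_leibniz nabla_conn sNa vxi vphiX Mp).
rewrite (connection_leibniz nabla_conn sb vxi vX Mp).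
rewrite (connection_leibniz nabla_conn sbe vxi vxi Mp).
rewrite (nabla_xiE (vector_field_sub kappa_neq0 vNxi vNX) Mp).
rewrite nabla_xi_xi// nabla_xi_phi//.
move: (dir_deriv M xi _ p) (dir_deriv M xi _ p) (dir_deriv M xi _ p) => c b a.
have TN : tangent M p (nabla X xi p) := vNxi.2 p Mp.
have TD : tangent M p (nabla xi X p) := vNX.2 p Mp.
have -> : phi p (nabla X xi p - nabla xi X p)
    = phi p (nabla X xi p) - phi p (nabla xi X p).
  by rewrite addrC -scaleN1r (tensor11_linear phiT _ Mp TD TN) scaleN1r addrC.
have gN : g p (nabla X xi p) u = - alpha p * g p (phi p (X p)) u + beta p * g p (X p) u.
  by rewrite (nabla_xiE vX Mp) !g3Dl !g3Zl xi_u mulr0 addr0.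
have gphiN : g p (phi p (nabla X xi p)) u
    = alpha p * g p (X p) u + beta p * g p (phi p (X p)) u.
  rewrite (g_phi_skew Mp TN Tu) (nabla_xiE vX Mp) !g3Dl !g3Zl.
  rewrite [g p (xi p) _]g3C (g_phi_xi Mp Tu) mulr0 addr0.
  rewrite (acm_compat acm Mp TX Tu) [eta p u](eta_g Mp Tu) [g p u _]g3C xi_u.
  rewrite -[g p (X p) (phi p u)]opprK -(g_phi_skew Mp TX Tu) mulr0 subr0.
  by rewrite mulrN opprD mulNr !opprK.
move=> /(congr1 (fun w => g p w u)).
have gh (x : R) w : g p (x *: (w.1, 0)) u = x * B w.1 u.1.
  by rewrite g3Zl g3E /= mul0r addr0.
rewrite !(g3Dl, g3Nl, gh) !(g3Zl, g3Dl, g3Nl) xi_u gN gphiN g3C g3_0r => E.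
rewrite mulrBr !mulrA -E.
move: (g p (X p) u) (g p (phi p (X p)) u) (g p (nabla xi X p) u).
move: (g p (phi p (nabla xi X p)) u) (eta p _) (eta p _) (alpha p) (beta p).
by move=> *; ring.
Qed.

Lemma xi_vertical p : M p -> (xi p).1 = 0.
Proof.
move=> Mp; have Txi := vxi.2 p Mp; have vT := vector_field_E3 (kappa := kappa) kappa_neq0.
have TT : tangent M p (E3 p) := vT.2 p Mp.
have [l [m lm]] := curvature_xi Mp.
set s := B (xi p).1 (xi p).1.
have sE : s + (xi p).2 * (xi p).2 = 1 := g_xi_xi Mp.
have gT w : g p (E3 p) w = w.2 by rewrite g3E ambient_form0l add0r mul1r.
have xiT : g p (xi p) (E3 p) = (xi p).2 by rewrite g3C gT.
(* This is the component u of [E3] orthogonal to xi, and g(E3, u) = 1 - (xi p).2^2 = s. *)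
have Tz : tangent M p (- (xi p).2 *: xi p + E3 p) by exact: tangent_lin.
have l_s : l * s = 0.
  have := lm _ _ vT Tz; rewrite !g3Dr !g3Zr (g_phi_xi Mp TT) (g_phi_id Mp TT).
  rewrite (g_xi_xi Mp) xiT !gT /= mulr1 addNr !ambient_form0l => /(_ erefl).
  rewrite !mulr0 mul0r subrr mulr0 !addr0 mulr0 addr0 => E.
  by rewrite E; congr (_ * _); lra.
have vN := vector_field_phi vT; set N := phi p (E3 p).
have TN : tangent M p N := vN.2 p Mp.
have N2 : N.2 = 0 by rewrite -(gT N) g3C (g_phi_id Mp TT).
have BN w : B N.1 w.1 = g p N w by rewrite g3E N2 mul0r addr0.
have gNN : g p N N = s.
  rewrite (acm_compat acm Mp TT TT) (eta_g Mp TT) !gT /= -sE; ring.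
have ss : s * s = 0.
  have := lm _ _ vN TN; rewrite [g p (xi p) _]g3C (g_phi_xi Mp TT) => /(_ erefl).
  rewrite !BN -/N (g_phi_xi Mp TT) gNN (g_phi_id Mp TN) mul0r subr0 mulr0 addr0 l_s.
  by move=> /eqP; rewrite mulf_eq0 (negPf kappa_neq0) /= => /eqP.
have s0 : s = 0 by move/eqP: ss; rewrite mulf_eq0 orbb => /eqP.
(* The ambient form may be indefinite, so s = 0 forces xi_h = 0 only through positivity on tangent
   vectors. *)
have Th : tangent M p ((xi p).1, 0).
  by apply: form_tangent => //=; exact: tangent_form.
apply/eqP/negPn/negP => xi1.
have u0 : ((xi p).1, 0) != 0 :> V by apply: contra xi1 => /eqP[->].
by have := metric_pos g_metric Mp Th u0; rewrite g3E /= -/s s0 mulr0 addr0 ltxx.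
Qed.

(** * Consequences of verticality *)

Lemma xi_snd_sqr p : M p -> (xi p).2 ^+ 2 = 1.
Proof.
move=> Mp; have := g_xi_xi Mp.
by rewrite g3E (xi_vertical Mp) ambient_form0l add0r expr2.
Qed.

(** The surface component is the derivative of zero. The other component vanishes because nabla_X xi
    is orthogonal to xi, whose second component is 1 or -1. *)
Lemma nabla_xi0 X p : vector_field M X -> M p -> nabla X xi p = 0.
Proof.
move=> vX Mp; have TX := vX.2 p Mp.
have := g_nabla_xi_xi vX Mp; rewrite g3E (xi_vertical Mp) ambient_form0r add0r.
have n1 : (nabla X xi p).1 = 0.
  rewrite (nablaE kappa_neq0 nabla_LC g_metric vX vxi Mp) (xi_vertical Mp).
  rewrite ambient_form0r mulr0 scale0r addr0 -(tangent_deriv_fst TX vxi.1).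
  rewrite -(tangent_deriv_cst TX (0 : 'rV[R]_3)).
  apply: (tangent_deriv_eq TX (smooth_on_fst vxi.1)) => q Mq; exact: xi_vertical.
move=> /eqP; rewrite mulf_eq0 => /orP[/eqP n2|/eqP xi2].
  by move: n1 n2; case: (nabla X xi p) => a b /= -> ->.
by have := xi_snd_sqr Mp; rewrite xi2 expr0n => /esym/eqP; rewrite oner_eq0.
Qed.

(** For p.1 = (x, y, z) the vector (-y, x, 0) is orthogonal to p.1 whatever the sign of kappa, as
    the first two coordinates enter the form with coefficient 1. Where x = 0, (1, 0, 0) serves
    instead. *)
Lemma horizontal_vector p : M p -> exists2 u, tangent M p u & u.2 = 0 /\ u != 0.
Proof.
move=> Mp.
have [p0|p0] := eqVneq (p.1 0 0) 0.
  exists (\row_(j < 3) (j == 0)%:R, 0).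
    by apply: form_tangent => //; rewrite /ambient_form !mxE /= p0; ring.
  split=> //; apply/eqP => /(congr1 (fun u : V => u.1 0 0)); rewrite !mxE /=.
  by move/eqP; rewrite oner_eq0.
exists (p.1 0 0 *: (\row_(j < 3) (j == 1)%:R) - p.1 0 1 *: (\row_(j < 3) (j == 0)%:R), 0).
  by apply: form_tangent => //; rewrite /ambient_form !mxE /=; ring.
split=> //; apply/eqP => /(congr1 (fun u : V => u.1 0 1)); rewrite !mxE /=.
by rewrite mulr1 mulr0 subr0 => /eqP; rewrite (negPf p0).
Qed.

(** As xi is parallel, - alpha phi u + beta u = 0 for a horizontal u; u and phi u are orthogonal and
    of the same nonzero length, so pairing with each isolates one coefficient. *)
Lemma alpha_beta0 p : M p -> alpha p = 0 /\ beta p = 0.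
Proof.
move=> Mp; have [u Tu [u2 u_neq0]] := horizontal_vector Mp.
have vX := vector_field_projected kappa_neq0 u.
have Xp := projected_field_id (kappa := kappa) (tangent_form Mp Tu).
have guxi : g p u (xi p) = 0.
  by rewrite g3E (xi_vertical Mp) u2 ambient_form0r mul0r addr0.
have := nabla_xiE vX Mp; rewrite nabla_xi0// Xp (eta_g Mp Tu) guxi.
rewrite mulr0 oppr0 scale0r addr0.
move=> E; have guu := metric_pos g_metric Mp Tu u_neq0.
have b0 : beta p = 0.
  have := congr1 (fun w => g p w u) E; rewrite g3Dl !g3Zl (g_phi_id Mp Tu).
  rewrite mulr0 add0r g3C g3_0r => /esym/eqP.
  by rewrite mulf_eq0 (gt_eqF guu) orbF => /eqP.
split=> //; move: E; rewrite b0 scale0r addr0 => E.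
have := congr1 (fun w => g p w (phi p u)) E; rewrite g3Zl (acm_compat acm Mp Tu Tu).
rewrite (eta_g Mp Tu) guxi mulr0 subr0 g3C g3_0r => /esym/eqP.
by rewrite mulf_eq0 (gt_eqF guu) orbF oppr_eq0 => /eqP.
Qed.

(** The second component of xi maps a connected component continuously onto an interval; if that
    contained both 1 and -1, it would contain 0. *)
Lemma xi_snd_component p q : M p -> connected_component M p q -> (xi q).2 = (xi p).2.
Proof.
move=> Mp Cq; have CM := @connected_component_sub _ M p.
have sqr r : connected_component M p r -> (xi r).2 = 1 \/ (xi r).2 = -1.
  by move=> /CM/xi_snd_sqr/eqP; rewrite sqrf_eq1 => /orP[]/eqP; [left|right].
have := connected_continuous_connected (component_connected (A := M) (x := p))
  (continuous_subspaceW CM (smooth_on_continuous (smooth_on_snd vxi.1))).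
move=> /connected_intervalP I.
have Cp := connected_component_refl Mp.
pose S := [set (xi r).2 | r in connected_component M p].
have Sp : S (xi p).2 by exists p.
have Sq : S (xi q).2 by exists q.
have nS0 : ~ S 0 by move=> [r /sqr[] -> /eqP]; rewrite ?oppr_eq0 oner_eq0.
have [Ep|Ep] := sqr p Cp; have [Eq|Eq] := sqr q Cq; rewrite ?Ep ?Eq//; exfalso.
- by apply/nS0/(I _ _ Sq Sp); rewrite Ep Eq; lra.
- by apply/nS0/(I _ _ Sp Sq); rewrite Ep Eq; lra.
Qed.

End TransSasakian.

Theorem theorem6p6 (R : realType) (kappa : R) (kappa_neq0 : kappa != 0)
    (nabla : ('rV[R]_3 * R -> 'rV[R]_3 * R) -> ('rV[R]_3 * R -> 'rV[R]_3 * R) ->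
             'rV[R]_3 * R -> 'rV[R]_3 * R)
    (nabla_LC : levi_civita (M3 kappa) (@g3 R kappa) nabla)
    (phi : 'rV[R]_3 * R -> 'rV[R]_3 * R -> 'rV[R]_3 * R)
    (xi : 'rV[R]_3 * R -> 'rV[R]_3 * R)
    (eta : 'rV[R]_3 * R -> 'rV[R]_3 * R -> R)
    (alpha beta : 'rV[R]_3 * R -> R)
    (structure : trans_sasakian (M3 kappa) nabla phi xi eta (@g3 R kappa)
                   alpha beta) :
  vertical (M3 kappa) xi /\
  (forall p, M3 kappa p ->
     (forall q, connected_component (M3 kappa) p q -> xi q = E3 q) \/
     (forall q, connected_component (M3 kappa) p q -> xi q = - E3 q)) /\
  cosymplectic (M3 kappa) nabla phi xi eta (@g3 R kappa) alpha beta.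
Proof.
have vert := xi_vertical kappa_neq0 nabla_LC structure.
split; first exact: vert.
split; last first.
  by split=> // p; exact: (alpha_beta0 kappa_neq0 nabla_LC structure).
move=> p Mp.
have xiE q : connected_component (M3 kappa) p q -> xi q = (0, (xi p).2).
  move=> Cq; rewrite -(xi_snd_component kappa_neq0 nabla_LC structure Mp Cq).
  by rewrite -(vert _ (connected_component_sub Cq)); case: (xi q).
have := xi_snd_sqr kappa_neq0 nabla_LC structure Mp.
move=> /eqP; rewrite sqrf_eq1 => /orP[]/eqP xi2; [left|right] => q /xiE ->.
  by rewrite xi2.
by rewrite xi2 /E3; congr pair; rewrite oppr0.
Qed.
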